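(* Suppose that the tensor linear system $\mathcal{A} * \mathcal{X} = \mathcal{B}$ is consistent, and let $\mathcal{X}^0 \in \mathbb{R}^{\ell\times p\times n}$ be an arbitrary initial tensor. Define $\mathcal{X}_*^0 = \mathcal{A}^\dagger * \mathcal{B} + (\mathcal{I} - \mathcal{A}^\dagger * \mathcal{A}) * \mathcal{X}^0$, and let $\{\mathcal{X}^k\}_{k\ge 0}$ be the sequence generated by the TKGK algorithm with truncation parameter $\tau\ge 1$. If $\mathcal{A} * \mathcal{X}^k = \mathcal{B}$, then $\mathcal{X}^k = \mathcal{X}_*^0$. Otherwise, $$\|\mathcal{X}^{k+1} - \mathcal{X}_*^0\|_F^2 \le (1 - \beta_k \zeta_k^2)\, \|\mathcal{X}^k - \mathcal{X}_*^0\|_F^2,$$ and $$1 - \beta_k\zeta_k^2 \le \rho_{\pi_k}.$$ Moreover, this last inequality is strict if $\|r_{\pi_k}(\mathcal{X}^k)\|_F^2 \ne \|\mathcal{X}^k - \mathcal{P}_{\pi_k}(\mathcal{X}^k)\|_F^2$.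
   Context: Tensor notation. For $\mathcal{A}\in\mathbb{R}^{m\times \ell\times n}$ let $A_1,\dots,A_n$ be its frontal slices. $\operatorname{bcirc}(\mathcal{A})\in\mathbb{R}^{mn\times \ell n}$ is the block circulant matrix whose first block column is $A_1,\dots,A_n$ (top to bottom) and whose $(i,j)$ block is $A_{((i-j) \bmod n)+1}$. $\operatorname{unfold}(\mathcal{A})\in\mathbb{R}^{mn\times \ell}$ stacks $A_1,\dots,A_n$ vertically, and $\operatorname{fold}$ is its inverse. The $t$-product is $\mathcal{A} * \mathcal{Y} = \operatorname{fold}(\operatorname{bcirc}(\mathcal{A})\operatorname{unfold}(\mathcal{Y}))$. $\mathcal{A}^\dagger$ is the tensor with $\operatorname{bcirc}(\mathcal{A}^\dagger)=\operatorname{bcirc}(\mathcal{A})^\dagger$ (Moore-Penrose). $\mathcal{I}$ is the identity tensor (first frontal slice the identity matrix, others zero). $\langle\cdot,\cdot\rangle$ is the entrywise inner product, $\|\cdot\|_F$ the induced norm, $\|\cdot\|_2$ the spectral norm (Euclidean norm for vectors). $\operatorname{vec}(\mathcal{A})$ stacks the column-wise vectorizations of $A_1,\dots,A_n$. $\mathcal{A}_{i::}\in\mathbb{R}^{1\times \ell\times n}$ is the $i$th horizontal slice. Problem: $\mathcal{A}\in\mathbb{R}^{m\times\ell\times n}$, $\mathcal{B}\in\mathbb{R}^{m\times p\times n}$, unknown $\mathcal{X}\in\mathbb{R}^{\ell\times p\times n}$. Projections. $\mathcal{P}_i(\mathcal{X}) = \mathcal{X} - \mathcal{A}_{i::}^\dagger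 * (\mathcal{A}_{i::}*\mathcal{X} - \mathcal{B}_{i::})$. For a permutation $\pi_k=(\pi_{k,1},\dots,\pi_{k,m})$ of $[m]=\{1,\dots,m\}$, $\mathcal{P}_{\pi_k} = \mathcal{P}_{\pi_{k,m}}\circ\cdots\circ\mathcal{P}_{\pi_{k,1}}$, and $r_{\pi_k}(\mathcal{X})\in\mathbb{R}^{mn\ell\times p}$ is the vertical stacking over $i=1,\dots,m$ of the blocks $$\operatorname{unfold}\big(\mathcal{A}_{\pi_{k,i}::}^\dagger * (\mathcal{A}_{\pi_{k,i}::} * (\mathcal{P}_{\pi_{k,i-1}}\circ\cdots\circ\mathcal{P}_{\pi_{k,1}})(\mathcal{X}) - \mathcal{B}_{\pi_{k,i}::})\big)$$ (for $i=1$ the composition is the identity). Further, $$\mathcal{T}_{\pi_k} = (\mathcal{I} - \mathcal{A}_{\pi_{k,m}::}^\dagger * \mathcal{A}_{\pi_{k,m}::}) * \cdots * (\mathcal{I} - \mathcal{A}_{\pi_{k,1}::}^\dagger * \mathcal{A}_{\pi_{k,1}::}),\qquad \rho_{\pi_k} = \|\operatorname{bcirc}(\mathcal{T}_{\pi_k} * \mathcal{A}^\dagger * \mathcal{A})\|_2^2 .$$ Permutation strategies: incremental (IS): $\pi_k=(1,\dots,m)$ for all $k$; shuffle-once (SO): one random permutation $\pi_0$ drawn at the start and $\pi_k=\pi_0$ for all $k$; random reshuffling (RR): a fresh random permutation $\pi_k$ of $[m]$ at each $k$. TKGK algorithm. Input $\mathcal{A},\mathcal{B}$, integer $\tau\ge1$,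 $\mathcal{X}^0$, and a strategy in $\{\mathrm{IS},\mathrm{SO},\mathrm{RR}\}$. For $k=0,1,\dots$: generate $\pi_k$; set $\delta_k=\|\mathcal{P}_{\pi_k}(\mathcal{X}^k)-\mathcal{X}^k\|_F^2$ and stop if $\delta_k=0$; set $\gamma_k=\tfrac12(\|r_{\pi_k}(\mathcal{X}^k)\|_F^2+\delta_k)$ and $j_{k,\tau}=\max\{k-\tau+1,0\}$; with $\vec{x}^i=\operatorname{vec}(\mathcal{X}^i)$, $\vec{d}^k=\operatorname{vec}(\mathcal{P}_{\pi_k}(\mathcal{X}^k)-\mathcal{X}^k)$ and $$M_k=[\vec{x}^{j_{k,\tau}}-\vec{x}^k,\dots,\vec{x}^{k-1}-\vec{x}^k,\vec{d}^k]\in\mathbb{R}^{\ell pn\times(k-j_{k,\tau}+1)},$$ let $s^k$ solve $M_k^\top M_k s^k=\gamma_k e$, where $e$ is the last standard basis vector of $\mathbb{R}^{k-j_{k,\tau}+1}$; set $$\mathcal{X}^{k+1}=\mathcal{X}^k+\sum_{i=1}^{k-j_{k,\tau}}s_i^k(\mathcal{X}^{j_{k,\tau}+i-1}-\mathcal{X}^k)+s^k_{k-j_{k,\tau}+1}(\mathcal{P}_{\pi_k}(\mathcal{X}^k)-\mathcal{X}^k).$$ Rate quantities (for $\mathcal{A}*\mathcal{X}^k\neq\mathcal{B}$). Let $V_k=[\vec{x}^{j_{k,\tau}}-\vec{x}^k,\dots,\vec{x}^{k-1}-\vec{x}^k]\in\mathbb{R}^{\ell pn\times(k-j_{k,\tau})}$;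 when it has no columns (in particular $V_0=\emptyset$), $V_kV_k^\dagger$ is the zero matrix. Then $$\beta_k=\Big(1-\frac{\|V_kV_k^\dagger\vec{d}^k\|_2^2}{\|\vec{d}^k\|_2^2}\Big)^{-1},\qquad \zeta_k=\frac{\langle\mathcal{X}^k-\mathcal{X}_*^0,\ \mathcal{X}^k-\mathcal{P}_{\pi_k}(\mathcal{X}^k)\rangle}{\|\mathcal{X}^k-\mathcal{X}_*^0\|_F\,\|\mathcal{P}_{\pi_k}(\mathcal{X}^k)-\mathcal{X}^k\|_F}.$$ *)

(* Defs.v *)
Set Warnings "-notation-overridden,-ambiguous-paths,-deprecated".
From HB Require Import structures.
From mathcomp Require Import all_boot all_order all_fingroup all_algebra.
From mathcomp Require Import all_classical reals.

Set Implicit Arguments.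
Unset Strict Implicit.
Unset Printing Implicit Defensive.

Import Order.TTheory GRing.Theory Num.Theory.

Local Open Scope ring_scope.
Local Open Scope classical_set_scope.

(* Real m x l x n.+1 tensors, given by their n.+1 frontal slices. The third
   dimension is a successor so that the slice indices form the group Z/n.+1;
   the frontal slices A_1, ..., A_n.+1 are numbered from 0 here. *)
Notation tensor R m l n := {ffun 'I_n.+1 -> 'M[R]_(m, l)}.

Section Matrices.
Variable R : realType.

Definition mxdot m l (A B : 'M[R]_(m, l)) : R := \sum_i \sum_j A i j * B i j.

(* Frobenius norm; on column vectors, the Euclidean norm. *)
Definition mxnorm m l (A : 'M[R]_(m, l)) : R := Num.sqrt (mxdot A A).

Definition specnorm m l (A : 'M[R]_(m, l)) : R :=
  sup [set mxnorm (A *m x) | x in [set x : 'cV[R]_l | mxnorm x <= 1]].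

Definition penrose m l (A : 'M[R]_(m, l)) (X : 'M[R]_(l, m)) : Prop :=
  [/\ A *m X *m A = A, X *m A *m X = X,
      (A *m X)^T = A *m X & (X *m A)^T = X *m A].

(* Moore-Penrose inverse; see mpinvP and penrose_uniq. *)
Definition mpinv m l (A : 'M[R]_(m, l)) : 'M[R]_(l, m) := xget 0 (penrose A).

End Matrices.

Section Tensors.
Variable R : realType.

(* Blocks are numbered from 0; the subtraction i - j is the one of Z/n.+1. *)
Definition bcirc m l n (A : tensor R m l n) :
    'M[R]_(\sum_(i < n.+1) m, \sum_(j < n.+1) l) :=
  \mxblock_(i < n.+1, j < n.+1) A (i - j).

Definition tunfold m l n (A : tensor R m l n) : 'M[R]_(\sum_(i < n.+1) m, l) :=
  \mxcol_(i < n.+1) A i.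

Definition tfold m l n (U : 'M[R]_(\sum_(i < n.+1) m, l)) : tensor R m l n :=
  [ffun i => submxcol U i].

Definition tmul m l p n (A : tensor R m l n) (Y : tensor R l p n) :
    tensor R m p n :=
  tfold (bcirc A *m tunfold Y).

(* See bcirc_tpinv and bcirc_inj. *)
Definition tpinv m l n (A : tensor R m l n) : tensor R l m n :=
  xget 0 [set X : tensor R l m n | bcirc X = mpinv (bcirc A)].

Definition tid m n : tensor R m m n := [ffun k => if k == 0 then 1%:M else 0].

Definition tdot m l n (A B : tensor R m l n) : R := \sum_k mxdot (A k) (B k).

Definition tnorm m l n (A : tensor R m l n) : R := Num.sqrt (tdot A A).

(* mxvec is row-major, hence the transpositions. *)
Definition tvec m l n (A : tensor R m l n) : 'cV[R]_(\sum_(k < n.+1) l * m) :=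
  \mxcol_(k < n.+1) (mxvec (A k)^T)^T.

Definition hslice m l n (A : tensor R m l n) (i : 'I_m) : tensor R 1 l n :=
  [ffun k => row i (A k)].

End Tensors.

Notation "A *t B" := (tmul A B) (at level 40, left associativity) : ring_scope.

Section Kaczmarz.
Variables (R : realType) (m l p n : nat).
Variables (A : tensor R m l n) (B : tensor R m p n).
Implicit Types (X : tensor R l p n) (s : seq 'I_m) (pi : 'S_m).

Definition proj (i : 'I_m) X : tensor R l p n :=
  X - tpinv (hslice A i) *t (hslice A i *t X - hslice B i).

(* The first index of s is applied first. *)
Definition sweep s X : tensor R l p n := foldl (fun Y i => proj i Y) X s.

Definition perm_seq pi : seq 'I_m := [seq pi i | i <- enum 'I_m].

Definition perm_proj pi X : tensor R l p n := sweep (perm_seq pi) X.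

Definition residual pi X : 'M[R]_(\sum_(i < m) \sum_(k < n.+1) l, p) :=
  \mxcol_(i < m)
    tunfold (tpinv (hslice A (pi i)) *t
             (hslice A (pi i) *t sweep (take i (perm_seq pi)) X
              - hslice B (pi i))).

Definition perm_tensor pi : tensor R l l n :=
  foldl (fun T i => (tid R l n - tpinv (hslice A i) *t hslice A i) *t T)
        (tid R l n) (perm_seq pi).

Definition rho pi : R := specnorm (bcirc (perm_tensor pi *t tpinv A *t A)) ^+ 2.

Definition delta pi X : R := tnorm (perm_proj pi X - X) ^+ 2.

Definition gamma pi X : R := (mxnorm (residual pi X) ^+ 2 + delta pi X) / 2.

(* max (k - tau + 1, 0): the subtraction on nat truncates. *)
Definition window_start (tau k : nat) : nat := (k.+1 - tau)%N.

Definition window_size (tau k : nat) : nat := (k - window_start tau k)%N.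

Definition Vmx (tau : nat) (X : nat -> tensor R l p n) (k : nat) :
    'M[R]_(\sum_(i < n.+1) p * l, window_size tau k) :=
  \matrix_(a, i) (tvec (X (window_start tau k + i)%N) - tvec (X k)) a 0.

Definition dvec pi X : 'cV[R]_(\sum_(i < n.+1) p * l) :=
  tvec (perm_proj pi X - X).

Definition Mmx (tau : nat) pi (X : nat -> tensor R l p n) (k : nat) :
    'M[R]_(\sum_(i < n.+1) p * l, window_size tau k + 1) :=
  row_mx (Vmx tau X k) (dvec pi (X k)).

Definition last_basis q : 'cV[R]_(q + 1) := delta_mx (rshift q 0) 0.

(* Iteration k of TKGK does not stop and, from X 0, ..., X k, it produces Y. *)
Definition tkgk_step (tau : nat) pi (X : nat -> tensor R l p n) (k : nat)
    (Y : tensor R l p n) : Prop :=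
  let M := Mmx tau pi X k in
  let q := window_size tau k in
  delta pi (X k) <> 0 /\
  exists s : 'cV[R]_(q + 1),
    M^T *m M *m s = gamma pi (X k) *: last_basis q /\
    Y = X k
        + \sum_(i < q) s (lshift 1 i) 0 *: (X (window_start tau k + i)%N - X k)
        + s (rshift q 0) 0 *: (perm_proj pi (X k) - X k).

(* X 0, ..., X N are the first N + 1 iterates of a TKGK run started at X0 (the
   run has not stopped before iteration N); X is arbitrary beyond N. *)
Definition tkgk_iterates (tau : nat) (X0 : tensor R l p n) (pi : nat -> 'S_m)
    (X : nat -> tensor R l p n) (N : nat) : Prop :=
  X 0%N = X0 /\
  forall k, (k < N)%N -> tkgk_step tau (pi k) X k (X k.+1).

Definition beta (tau : nat) pi (X : nat -> tensor R l p n) (k : nat) : R :=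
  let V := Vmx tau X k in
  let d := dvec pi (X k) in
  (1 - mxnorm (V *m mpinv V *m d) ^+ 2 / mxnorm d ^+ 2)^-1.

Definition xstar X0 : tensor R l p n :=
  tpinv A *t B + (tid R l n - tpinv A *t A) *t X0.

Definition zeta pi X0 X : R :=
  tdot (X - xstar X0) (X - perm_proj pi X)
  / (tnorm (X - xstar X0) * tnorm (perm_proj pi X - X)).

End Kaczmarz.

Inductive strategy := IS | SO | RR.

(* The sequences of permutations that a strategy can draw. *)
Definition strategy_outcome m (S : strategy) (pi : nat -> 'S_m) : Prop :=
  match S with
  | IS => forall k, pi k = 1%g
  | SO => exists pi0, forall k, pi k = pi0
  | RR => True
  end.

Section MoorePenrose.
Variable R : realType.

Lemma mulTmx_eq0 m l (A : 'M[R]_(m, l)) : A^T *m A = 0 -> A = 0.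
Proof.
move=> h; apply/matrixP => i j; rewrite mxE.
have /matrixP/(_ j j) := h; rewrite !mxE => /eqP.
rewrite psumr_eq0; last by move=> k _; rewrite mxE -expr2 sqr_ge0.
by move=> /allP/(_ i (mem_index_enum i)); rewrite mxE -expr2 sqrf_eq0 => /eqP.
Qed.

Lemma gram_unit m l (A : 'M[R]_(m, l)) : row_free A -> A *m A^T \in unitmx.
Proof.
move=> fA; rewrite -row_free_unit -kermx_eq0; apply/eqP.
have h : (kermx (A *m A^T) *m A)^T = 0.
  apply: mulTmx_eq0; rewrite trmxK trmx_mul mulmxA -(mulmxA _ A) mulmx_ker.
  by rewrite mul0mx.
apply: (row_free_inj fA); rewrite mul0mx.
by apply: trmx_inj; rewrite h trmx0.
Qed.

Lemma penrose_ex m l (A : 'M[R]_(m, l)) : exists X, penrose A X.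
Proof.
set C := col_base A; set F := row_base A.
have uF : F *m F^T \in unitmx by apply: gram_unit; exact: row_base_free.
have uC : C^T *m C \in unitmx.
  rewrite -{2}[C]trmxK; apply: gram_unit.
  by rewrite /row_free mxrank_tr -/(row_full C) col_base_full.
have AE : A = C *m F by rewrite mulmx_base.
move: uF uC AE; clearbody C F; move: (\rank A) C F => r C F uF uC ->.
set X := F^T *m invmx (F *m F^T) *m (invmx (C^T *m C) *m C^T).
have AX : C *m F *m X = C *m invmx (C^T *m C) *m C^T.
  rewrite /X -!mulmxA (mulmxA F F^T) (mulmxA (F *m F^T)) mulmxV //.
  by rewrite mul1mx.
have XA : X *m (C *m F) = F^T *m invmx (F *m F^T) *m F.
  by rewrite /X -!mulmxA (mulmxA C^T C) mulKmx.
have trinv k (U : 'M[R]_k) : U^T = U -> (invmx U)^T = invmx U.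
  by move=> h; rewrite trmx_inv h.
exists X; split.
- by rewrite AX -!mulmxA (mulmxA C^T C) mulKmx.
- by rewrite XA /X -!mulmxA (mulmxA F F^T) mulKmx.
- rewrite AX 2!trmx_mul trmxK trinv ?mulmxA //.
  by rewrite trmx_mul trmxK.
- rewrite XA 2!trmx_mul trmxK trinv ?mulmxA //.
  by rewrite trmx_mul trmxK.
Qed.

Lemma penrose_uniq m l (A : 'M[R]_(m, l)) X Y :
  penrose A X -> penrose A Y -> X = Y.
Proof.
case=> [x1 x2 x3 x4] [y1 y2 y3 y4].
have AXY : A *m X = A *m Y.
  rewrite -x3 -{1}y1 -(mulmxA _ A X) trmx_mul x3 y3 mulmxA.
  by rewrite x1.
have XYA : X *m A = Y *m A.
  rewrite -x4 -{1}y1 -(mulmxA A) mulmxA trmx_mul x4 y4 -mulmxA.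
  by rewrite (mulmxA A) x1.
by rewrite -x2 -mulmxA AXY mulmxA XYA y2.
Qed.

Lemma mpinvP m l (A : 'M[R]_(m, l)) : penrose A (mpinv A).
Proof. by apply: xgetPex; exact: penrose_ex. Qed.

End MoorePenrose.

Section TensorPseudoinverse.
Variables (R : realType) (n : nat).

Definition blockshift m l (c : 'I_n.+1)
    (M : 'M[R]_(\sum_(i < n.+1) m, \sum_(j < n.+1) l)) :
    'M[R]_(\sum_(i < n.+1) m, \sum_(j < n.+1) l) :=
  \mxblock_(i < n.+1, j < n.+1) submxblock M (i + c) (j + c).

Lemma blockshift_mul m l p c (M : 'M[R]_(_, \sum_(j < n.+1) l)) N :
  @blockshift m p c (M *m N) = blockshift c M *m blockshift c N.
Proof.
rewrite /blockshift mul_mxblock; apply: eq_mxblock => i j.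
rewrite -[M in LHS]submxblockK -[N in LHS]submxblockK mul_mxblock mxblockK.
by rewrite (reindex_inj (addIr c)).
Qed.

Lemma blockshift_tr m l c M : (@blockshift m l c M)^T = blockshift c M^T.
Proof.
rewrite /blockshift tr_mxblock; apply: eq_mxblock => i j.
by apply/matrixP => a b; rewrite !mxE.
Qed.

Lemma blockshift_bcirc m l c (A : tensor R m l n) :
  blockshift c (bcirc A) = bcirc A.
Proof.
apply: eq_mxblock => i j; rewrite mxblockK.
by rewrite opprD addrACA subrr addr0.
Qed.

Lemma bcirc_inj m l : injective (@bcirc R m l n).
Proof.
move=> A A' e; apply/ffunP => i.
have /(congr1 (fun M => submxblock M i 0)) := e.
by rewrite !mxblockK subr0.
Qed.

Lemma bcirc_tpinv m l (A : tensor R m l n) :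
  bcirc (tpinv A) = mpinv (bcirc A).
Proof.
rewrite /tpinv; apply: (@xgetPex _ 0 [set X | bcirc X = mpinv (bcirc A)]).
set P := mpinv _.
have shP c : blockshift c P = P.
  have [p1 p2 p3 p4] := mpinvP (bcirc A).
  apply: (@penrose_uniq _ _ _ (bcirc A)); last exact: mpinvP.
  have : penrose (blockshift c (bcirc A)) (blockshift c P).
    split; rewrite -!blockshift_mul ?blockshift_tr ?p1 ?p2 ?p3 ?p4 //.
  by rewrite blockshift_bcirc.
exists [ffun i => submxblock P i 0].
rewrite /= -[RHS]submxblockK; apply: eq_mxblock => i j; rewrite ffunE.
by rewrite -{1}(shP j) /blockshift mxblockK subrK add0r.
Qed.

End TensorPseudoinverse.

(* Main.v *)
(* Let X* = xstar, e = X^k - X* and d = P(X^k) - X^k, P being one sweep. Each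
   row projection moves X - X* by an orthogonal projection, so Pythagoras along
   the sweep gives |r|^2 = |e|^2 - |P(X^k) - X*|^2, i.e. gamma = -<e, d>.  By
   induction the error stays in the row range of A and orthogonal to the
   differences in the window, so the right-hand side of the normal equations is
   -M^T e: the step subtracts from e its orthogonal projection onto the range of
   M.  With d' = d - V V^+ d in that range, Cauchy-Schwarz yields
   |e_new|^2 <= |e|^2 - gamma^2 / |d'|^2 = (1 - beta zeta^2) |e|^2.  Finally
   gamma^2 / |d'|^2 >= gamma^2 / |d|^2 >= 2 gamma - |d|^2
   = |e|^2 - |P(X^k) - X*|^2 >= (1 - rho) |e|^2, and the second inequality is
   strict unless gamma = |d|^2, i.e. unless |r|^2 = |d|^2. *)
Require Import Defs.
From HB Require Import structures.
From mathcomp Require Import all_boot all_order all_fingroup all_algebra.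
From mathcomp Require Import all_classical reals.
From mathcomp Require Import ring lra.

Set Implicit Arguments.
Unset Strict Implicit.
Unset Printing Implicit Defensive.

Import Order.TTheory GRing.Theory Num.Theory.

Local Open Scope ring_scope.

(** * Frobenius inner product of matrices *)

Section FrobeniusInnerProduct.
Variables (R : realType) (m l : nat).
Implicit Types (X Y Z : 'M[R]_(m, l)).

Lemma mxdot_trace X Y : mxdot X Y = \tr (X^T *m Y).
Proof.
rewrite /mxdot exchange_big; apply: eq_bigr => j _.
by rewrite mxE; apply: eq_bigr => i _; rewrite mxE.
Qed.

Lemma mxdotC X Y : mxdot X Y = mxdot Y X.
Proof. by apply: eq_bigr => i _; apply: eq_bigr => j _; rewrite mulrC. Qed.

Lemma mxdotDl X Y Z : mxdot (X + Y) Z = mxdot X Z + mxdot Y Z.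
Proof. by rewrite !mxdot_trace linearD mulmxDl linearD. Qed.

Lemma mxdotDr X Y Z : mxdot X (Y + Z) = mxdot X Y + mxdot X Z.
Proof. by rewrite mxdotC mxdotDl !(mxdotC X). Qed.

Lemma mxdotNl X Y : mxdot (- X) Y = - mxdot X Y.
Proof. by rewrite !mxdot_trace linearN mulNmx linearN. Qed.

Lemma mxdotNr X Y : mxdot X (- Y) = - mxdot X Y.
Proof. by rewrite mxdotC mxdotNl mxdotC. Qed.

Lemma mxdotZl c X Y : mxdot (c *: X) Y = c * mxdot X Y.
Proof. by rewrite !mxdot_trace linearZ -scalemxAl linearZ. Qed.

Lemma mxdotZr c X Y : mxdot X (c *: Y) = c * mxdot X Y.
Proof. by rewrite mxdotC mxdotZl mxdotC. Qed.

Lemma mxdot0r X : mxdot X 0 = 0.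
Proof. by rewrite mxdot_trace mulmx0 linear0. Qed.

Lemma mxdot0l X : mxdot 0 X = 0.
Proof. by rewrite mxdotC mxdot0r. Qed.

Lemma mxdot_ge0 X : 0 <= mxdot X X.
Proof. by apply: sumr_ge0 => i _; apply: sumr_ge0 => j _; apply: sqr_ge0. Qed.

Lemma mxdot_eq0 X : (mxdot X X == 0) = (X == 0).
Proof.
apply/eqP/eqP => [|->]; last exact: mxdot0r.
move=> /psumr_eq0P h; apply/matrixP => i j; rewrite mxE.
have /psumr_eq0P h1 : \sum_j X i j * X i j = 0.
  by apply: h => // i' _; apply: sumr_ge0 => j' _; apply: sqr_ge0.
by apply/eqP; rewrite -sqrf_eq0 expr2 h1 // => j' _; apply: sqr_ge0.
Qed.

Lemma mxdot_gt0 X : (0 < mxdot X X) = (X != 0).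
Proof. by rewrite lt_neqAle mxdot_ge0 andbT eq_sym mxdot_eq0. Qed.

Lemma mxnorm_sqr X : mxnorm X ^+ 2 = mxdot X X.
Proof. by rewrite sqr_sqrtr ?mxdot_ge0. Qed.

Lemma mxnorm_ge0 X : 0 <= mxnorm X.
Proof. exact: sqrtr_ge0. Qed.

(** Expanding the square of [<Y,Y> X - <X,Y> Y] gives [<Y,Y>] times the gap between the two sides;
    only [Y = 0] needs separate treatment. *)
Lemma mxdot_CauchySchwarz X Y : mxdot X Y ^+ 2 <= mxdot X X * mxdot Y Y.
Proof.
have [->|Y0] := eqVneq Y 0; first by rewrite !mxdot0r mulr0 expr0n.
move: (Y0); rewrite -mxdot_gt0 => Ypos.
have := mxdot_ge0 (mxdot Y Y *: X - mxdot X Y *: Y).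
rewrite !(mxdotDl, mxdotDr, mxdotNl, mxdotNr, mxdotZl, mxdotZr) (mxdotC Y X).
set a := mxdot X X; set b := mxdot X Y; set c := mxdot Y Y => h.
rewrite -subr_ge0 -(pmulr_rge0 _ Ypos) -/c.
by apply: le_trans h _; rewrite le_eqVlt; apply/orP; left; apply/eqP; ring.
Qed.

End FrobeniusInnerProduct.

Lemma mxdot_adj (R : realType) q m l (P : 'M[R]_(q, m)) (X : 'M[R]_(m, l)) Y :
  mxdot (P *m X) Y = mxdot X (P^T *m Y).
Proof. by rewrite !mxdot_trace trmx_mul mulmxA. Qed.

Lemma mxdot_sum_col (R : realType) m l (X Y : 'M[R]_(m, l)) :
  mxdot X Y = \sum_j mxdot (col j X) (col j Y).
Proof.
rewrite /mxdot exchange_big; apply: eq_bigr => j _; apply: eq_bigr => i _.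
by rewrite big_ord1 !mxE.
Qed.

(** * The spectral norm as an operator bound *)

Section SpectralNorm.
Variables (R : realType) (m l : nat) (M : 'M[R]_(m, l)).

(** Cauchy-Schwarz row by row. This crude Frobenius bound shows that the set defining [specnorm] is
    bounded above, so that its supremum really dominates its elements. *)
Lemma mxdot_mulmx_col (x : 'cV[R]_l) :
  mxdot (M *m x) (M *m x) <= mxdot M M * mxdot x x.
Proof.
rewrite /mxdot mulr_suml; apply: ler_sum => i _.
rewrite big_ord1 -expr2.
have -> : (M *m x) i 0 = mxdot (row i M)^T x.
  by rewrite mxE; apply: eq_bigr => j _; rewrite big_ord1 !mxE.
apply: le_trans (mxdot_CauchySchwarz _ _) _.
rewrite le_eqVlt; apply/orP; left; apply/eqP; congr (_ * _).
by apply: eq_bigr => j _; rewrite big_ord1 !mxE.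
Qed.

Lemma specnorm_mulmx_col (x : 'cV[R]_l) :
  mxnorm (M *m x) <= specnorm M * mxnorm x.
Proof.
have [->|x0] := eqVneq x 0.
  by rewrite mulmx0 /mxnorm !mxdot0r sqrtr0 mulr0.
have nx : 0 < mxnorm x by rewrite sqrtr_gt0 mxdot_gt0.
have normZ q c (y : 'cV[R]_q) : 0 <= c -> mxnorm (c *: y) = c * mxnorm y.
  move=> c0; rewrite /mxnorm mxdotZl mxdotZr mulrA -expr2.
  by rewrite sqrtrM ?sqr_ge0 // sqrtr_sqr ger0_norm.
have nx' : 0 <= (mxnorm x)^-1 by rewrite invr_ge0 ltW.
(* Scaling [x] to norm one places the quotient in the set whose supremum is [specnorm M]. *)
rewrite -ler_pdivrMr // mulrC -normZ // scalemxAr.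
apply: ub_le_sup; last first.
  exists ((mxnorm x)^-1 *: x) => //=.
  by rewrite normZ // mulVf ?gt_eqF.
exists (mxnorm M) => _ [y /= y1 <-].
apply: ler_wsqrtr; apply: le_trans (mxdot_mulmx_col y) _.
by rewrite ler_piMr ?mxdot_ge0 //  -mxnorm_sqr expr_le1 ?mxnorm_ge0.
Qed.

Lemma specnorm_mulmx p (X : 'M[R]_(l, p)) :
  mxdot (M *m X) (M *m X) <= specnorm M ^+ 2 * mxdot X X.
Proof.
rewrite !(mxdot_sum_col _ _) mulr_sumr; apply: ler_sum => j _.
have h := specnorm_mulmx_col (col j X).
have -> : col j (M *m X) = M *m col j X by rewrite !colE mulmxA.
rewrite -!mxnorm_sqr -exprMn.
by apply: lerXn2r => //;
  rewrite nnegrE ?mxnorm_ge0 // (le_trans _ h) ?mxnorm_ge0.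
Qed.

End SpectralNorm.

(** * One iteration as a least-squares projection of the error *)

Section ProjectionStep.
Variables (R : realType) (N q : nat) (V : 'M[R]_(N, q)) (d e : 'cV[R]_N).
Variable g : R.
Hypotheses (Ve : V^T *m e = 0) (de : mxdot e d = - g).
Let M := row_mx V d.

(** [Ve] clears the window entries and [de] gives the last one. With [e] the current error, the
    system for [s] thus reads [M^T (e + M s) = 0], the normal equations of least squares. *)
Lemma normal_equations_rhs : M^T *m e = - (g *: last_basis R q).
Proof.
rewrite tr_row_mx mul_col_mx Ve; apply/matrixP => i j.
rewrite !mxE; case: splitP => i' ei; rewrite !mxE ?ord1.
  rewrite (_ : i == _ = false) ?mulr0 ?oppr0 //.
  by apply/negbTE; rewrite -val_eqE /= ei addn0 ltn_eqF.
rewrite (_ : i == _ = true) ?mulr1 -?de; last first.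
  by apply/eqP/val_inj; rewrite /= ei ord1.
by apply: eq_bigr => a _; rewrite big_ord1 !mxE mulrC.
Qed.

(** No independence of the columns of [M] is assumed: [M M^+] is symmetric, whence
    [M^T M M^+ = M^T], and [s = - M^+ e] works. *)
Lemma normal_equations_solvable : exists s, M^T *m M *m s = g *: last_basis R q.
Proof.
have [h1 _ h3 _] := mpinvP M.
exists (- (mpinv M *m e)).
rewrite -[RHS]opprK -normal_equations_rhs mulmxN; congr (- _).
by rewrite -mulmxA (mulmxA M) -h3 mulmxA -trmx_mul h1.
Qed.

(** [W] is the orthogonal projection onto the column space of [V], and [d'] is the component of [d]
    orthogonal to that space. *)
Let W := V *m mpinv V.
Let d' := d - W *m d.

(** Pythagoras for the projection [W]. For [d] nonzero, the right-hand side is [|d|^2] divided by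
    the rate quantity [beta]. *)
Lemma complement_sqr : mxdot d' d' = mxdot d d - mxnorm (W *m d) ^+ 2.
Proof.
have [h1 _ h3 _] := mpinvP V.
have WdE : mxdot d (W *m d) = mxdot (W *m d) (W *m d).
  by rewrite mxdot_adj h3 !mulmxA h1.
rewrite mxnorm_sqr !(mxdotDl, mxdotDr, mxdotNl, mxdotNr) (mxdotC (W *m d)).
by rewrite WdE; ring.
Qed.

(** [W d] lies in the column space of [V], to which [e] is orthogonal, so removing it does not
    change the product with [e]. *)
Lemma error_complement : mxdot e d' = - g.
Proof.
by rewrite mxdotDr mxdotNr de mxdotC -mulmxA mxdot_adj Ve mxdot0r subr0.
Qed.

(** If [d'] vanished, so would its inner product [- g] with [e]. *)
Lemma complement_gt0 : g != 0 -> 0 < mxdot d d - mxnorm (W *m d) ^+ 2.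
Proof.
move=> g0; rewrite -complement_sqr mxdot_gt0; apply: contra_neq g0 => d'0.
by rewrite -[g]opprK -error_complement d'0 mxdot0r oppr0.
Qed.

Variables (s : 'cV[R]_(q + 1)) (hs : M^T *m M *m s = g *: last_basis R q).

Lemma new_error_orth : M^T *m (e + M *m s) = 0.
Proof. by rewrite mulmxDr mulmxA hs normal_equations_rhs addNr. Qed.

(** The new error is orthogonal to the range of [M], so the squared error drops by exactly
    [|M s|^2]. As [d'] lies in that range, [<M s, d'> = g], and Cauchy-Schwarz bounds [|M s|^2] from
    below. *)
Lemma new_error_norm : g != 0 ->
  mxdot (e + M *m s) (e + M *m s) <=
  mxdot e e - g ^+ 2 / (mxdot d d - mxnorm (W *m d) ^+ 2).
Proof.
move=> g0; rewrite -complement_sqr.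
have d'M : d' = M *m col_mx (- (mpinv V *m d)) 1%:M.
  by rewrite mul_row_col mulmx1 mulmxN mulmxA addrC.
have orth t : mxdot (e + M *m s) (M *m t) = 0.
  by rewrite mxdotC mxdot_adj new_error_orth mxdot0r.
have sd' : mxdot (M *m s) d' = g.
  have := orth (col_mx (- (mpinv V *m d)) 1%:M).
  rewrite -d'M mxdotDl error_complement => /eqP.
  by rewrite addrC subr_eq0 => /eqP.
have ss : mxdot e (M *m s) = - mxdot (M *m s) (M *m s).
  by have := orth s; rewrite mxdotDl => /eqP; rewrite addr_eq0 => /eqP.
have -> : mxdot (e + M *m s) (e + M *m s) = mxdot e e - mxdot (M *m s) (M *m s).
  by rewrite mxdotDr orth addr0 mxdotDl (mxdotC _ e) ss.
rewrite lerD2l lerN2 ler_pdivrMr; last by rewrite complement_sqr complement_gt0.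
by rewrite -{1}sd' mxdot_CauchySchwarz.
Qed.

End ProjectionStep.

(** * Tensor inner products and the algebra of the t-product *)

Lemma mxdot_mxcol (R : realType) q (r : 'I_q -> nat) p
    (X Y : forall i, 'M[R]_(r i, p)) :
  mxdot (\mxcol_i X i) (\mxcol_i Y i) = \sum_i mxdot (X i) (Y i).
Proof.
rewrite mxdot_trace tr_mxcol mul_mxrow_mxcol linear_sum.
by apply: eq_bigr => i _; rewrite mxdot_trace.
Qed.

Section TensorAlgebra.
Variables (R : realType) (n : nat).

Lemma tunfold_is_linear m l : linear (@tunfold R m l n).
Proof. by move=> c X Y; apply/matrixP => a b; rewrite !(mxE, ffunE). Qed.

HB.instance Definition _ m l :=
  GRing.isLinear.Build R _ _ _ (@tunfold R m l n) (@tunfold_is_linear m l).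

Lemma tvec_is_linear m l : linear (@tvec R m l n).
Proof.
move=> c X Y; apply/matrixP => a b.
by rewrite !mxE !ffunE !(linearD, linearZ) !mxE.
Qed.

HB.instance Definition _ m l :=
  GRing.isLinear.Build R _ _ _ (@tvec R m l n) (@tvec_is_linear m l).

Lemma tvecD m l (X Y : tensor R m l n) : tvec (X + Y) = tvec X + tvec Y.
Proof. exact: linearD. Qed.

Lemma tvecB m l (X Y : tensor R m l n) : tvec (X - Y) = tvec X - tvec Y.
Proof. exact: linearB. Qed.

Lemma tunfold_inj m l : injective (@tunfold R m l n).
Proof. by move=> X Y /eq_mxcolP h; apply/ffunP. Qed.

Lemma tunfoldM m l p (A : tensor R m l n) (Y : tensor R l p n) :
  tunfold (A *t Y) = bcirc A *m tunfold Y.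
Proof.
rewrite -[RHS]submxcolK; apply: eq_mxcol => i; exact: ffunE.
Qed.

Lemma tmulE m l p (A : tensor R m l n) (Y : tensor R l p n) k :
  (A *t Y) k = \sum_j A (k - j) *m Y j.
Proof. by rewrite ffunE /bcirc /tunfold mul_mxblock_mxrow mxcolK. Qed.

(** Shifting the summation index by the block column [j] turns the block sum into a circular
    convolution. Multiplicativity carries associativity and the Penrose identities over to
    tensors. *)
Lemma bcircM m l p (A : tensor R m l n) (Y : tensor R l p n) :
  bcirc (A *t Y) = bcirc A *m bcirc Y.
Proof.
rewrite /bcirc mul_mxblock; apply: eq_mxblock => i j.
rewrite tmulE [RHS](reindex_inj (addIr j)); apply: eq_bigr => k _.
by rewrite addrK opprD [- k - j]addrC addrA.
Qed.

Lemma bcircB m l (A A' : tensor R m l n) : bcirc (A - A') = bcirc A - bcirc A'.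
Proof.
by rewrite /bcirc -mxblockB; apply: eq_mxblock => i j; rewrite !ffunE.
Qed.

Lemma tmulA m l p q (A : tensor R m l n) (B : tensor R l p n)
    (C : tensor R p q n) : A *t (B *t C) = A *t B *t C.
Proof. by apply: tunfold_inj; rewrite !tunfoldM bcircM mulmxA. Qed.

Lemma tmul1 m l (A : tensor R m l n) : tid R m n *t A = A.
Proof.
apply/ffunP => k; rewrite tmulE (bigD1 k) //= subrr ffunE eqxx mul1mx.
rewrite big1 ?addr0 // => j jk; rewrite ffunE subr_eq0 eq_sym (negbTE jk).
by rewrite mul0mx.
Qed.

Lemma tmulBl m l p (A A' : tensor R m l n) (Y : tensor R l p n) :
  (A - A') *t Y = A *t Y - A' *t Y.
Proof. by apply: tunfold_inj; rewrite linearB /= !tunfoldM bcircB mulmxBl. Qed.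

Lemma tmul_is_linear m l p (A : tensor R m l n) : linear (@tmul R m l p n A).
Proof.
move=> c X Y; apply: tunfold_inj.
by rewrite tunfoldM !linearP /= !tunfoldM.
Qed.

HB.instance Definition _ m l p (A : tensor R m l n) :=
  GRing.isLinear.Build R _ _ _ (@tmul R m l p n A) (@tmul_is_linear m l p A).

Lemma tmulDr m l p (A : tensor R m l n) (X Y : tensor R l p n) :
  A *t (X + Y) = A *t X + A *t Y.
Proof. exact: linearD. Qed.

Lemma tmulBr m l p (A : tensor R m l n) (X Y : tensor R l p n) :
  A *t (X - Y) = A *t X - A *t Y.
Proof. exact: linearB. Qed.

Lemma tmulZr m l p (A : tensor R m l n) c (X : tensor R l p n) :
  A *t (c *: X) = c *: (A *t X).
Proof. exact: linearZ. Qed.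

Lemma tmul0r m l p (A : tensor R m l n) : A *t (0 : tensor R l p n) = 0.
Proof. exact: linear0. Qed.

Lemma tdot0l m l (X : tensor R m l n) : tdot 0 X = 0.
Proof. by apply: big1 => k _; rewrite ffunE mxdot0l. Qed.

Lemma tdot_tunfold m l (X Y : tensor R m l n) :
  tdot X Y = mxdot (tunfold X) (tunfold Y).
Proof. by rewrite mxdot_mxcol. Qed.

(** [curry_mxvec_bij] matches the entries of a vectorized slice with index pairs; the transposition
    in [tvec] accounts for the exchange of the two sums. *)
Lemma tdot_tvec m l (X Y : tensor R m l n) : tdot X Y = mxdot (tvec X) (tvec Y).
Proof.
rewrite mxdot_mxcol; apply: eq_bigr => k _.
rewrite /mxdot exchange_big pair_big /=.
under [RHS]eq_bigr do rewrite big_ord1 !mxE.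
rewrite (reindex _ (curry_mxvec_bij _ _)) /=.
by apply: eq_bigr => -[i j] _ /=; rewrite !mxvecE !mxE.
Qed.

Lemma tnorm_sqr m l (X : tensor R m l n) : tnorm X ^+ 2 = tdot X X.
Proof. by rewrite tdot_tunfold -mxnorm_sqr /mxnorm -tdot_tunfold. Qed.

Lemma tdot_eq0 m l (X : tensor R m l n) : (tdot X X == 0) = (X == 0).
Proof.
by rewrite tdot_tunfold mxdot_eq0 -(inj_eq (@tunfold_inj _ _)) linear0.
Qed.

Lemma hslice_tmul m l p (A : tensor R m l n) (Y : tensor R l p n) i :
  hslice (A *t Y) i = hslice A i *t Y.
Proof.
apply/ffunP => k; rewrite ffunE !tmulE linear_sum.
by apply: eq_bigr => j _ /=; rewrite row_mul !ffunE.
Qed.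

Lemma hslice_inj m l (A A' : tensor R m l n) :
  (forall i, hslice A i = hslice A' i) -> A = A'.
Proof.
move=> h; apply/ffunP => k; apply/row_matrixP => i.
by have /ffunP/(_ k) := h i; rewrite !ffunE.
Qed.

Lemma tdotC m l (X Y : tensor R m l n) : tdot X Y = tdot Y X.
Proof. by rewrite !tdot_tunfold mxdotC. Qed.

Lemma tdotDl m l (X Y Z : tensor R m l n) :
  tdot (X + Y) Z = tdot X Z + tdot Y Z.
Proof. by rewrite !tdot_tunfold linearD mxdotDl. Qed.

Lemma tdotNl m l (X Y : tensor R m l n) : tdot (- X) Y = - tdot X Y.
Proof. by rewrite !tdot_tunfold linearN mxdotNl. Qed.

Lemma tdotDr m l (X Y Z : tensor R m l n) :
  tdot X (Y + Z) = tdot X Y + tdot X Z.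
Proof. by rewrite tdotC tdotDl !(tdotC X). Qed.

Lemma tdotNr m l (X Y : tensor R m l n) : tdot X (- Y) = - tdot X Y.
Proof. by rewrite tdotC tdotNl tdotC. Qed.

Definition tdotE := (tdotDl, tdotDr, tdotNl, tdotNr).

(** * Orthogonal projection onto the row range of a tensor *)

Section RangeProjection.
Variables (m l : nat) (A : tensor R m l n).

Lemma tmul_tpinvK : A *t tpinv A *t A = A.
Proof.
apply: bcirc_inj; rewrite !bcircM bcirc_tpinv.
by have [] := mpinvP (bcirc A).
Qed.

Lemma tpinv_proj_idem p (X : tensor R l p n) :
  tpinv A *t A *t (tpinv A *t A *t X) = tpinv A *t A *t X.
Proof. by rewrite -!tmulA (tmulA A) (tmulA (A *t _)) tmul_tpinvK. Qed.

Lemma tpinv_proj_sym p (X Y : tensor R l p n) :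
  tdot (tpinv A *t A *t X) Y = tdot X (tpinv A *t A *t Y).
Proof.
rewrite !tdot_tunfold !tunfoldM bcircM bcirc_tpinv mxdot_adj.
by have [_ _ _ ->] := mpinvP (bcirc A).
Qed.

Lemma tpinv_proj_pythagoras p (X : tensor R l p n) :
  tdot (tpinv A *t A *t X) (tpinv A *t A *t X) =
  tdot X X - tdot (X - tpinv A *t A *t X) (X - tpinv A *t A *t X).
Proof.
have h : tdot (tpinv A *t A *t X) (tpinv A *t A *t X)
       = tdot X (tpinv A *t A *t X) by rewrite tpinv_proj_sym tpinv_proj_idem.
by rewrite !tdotE (tdotC _ X) h; ring.
Qed.

End RangeProjection.

End TensorAlgebra.

(** * Error of a sweep of row projections, relative to any solution *)

Section Sweeps.
Variables (R : realType) (m l p n : nat).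
Variables (A : tensor R m l n) (B : tensor R m p n) (Z : tensor R l p n).
Hypothesis AZ : A *t Z = B.
Implicit Types (X E : tensor R l p n) (s : seq 'I_m) (pi : 'S_m).

Local Notation Q i := (tpinv (hslice A i) *t hslice A i).
Local Notation C := (tpinv A *t A).

(** Since [Z] is a solution, [hslice B i] is the image of [Z], so a correction depends only on the
    error. *)
Lemma correctionE i X :
  tpinv (hslice A i) *t (hslice A i *t X - hslice B i) = Q i *t (X - Z).
Proof. by rewrite -AZ hslice_tmul -tmulBr tmulA. Qed.

Lemma proj_error i X : Defs.proj A B i X - Z = X - Z - Q i *t (X - Z).
Proof. by rewrite /Defs.proj correctionE addrAC. Qed.

Lemma sweep_rcons s i X :
  sweep A B (rcons s i) X = Defs.proj A B i (sweep A B s X).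
Proof. by rewrite /sweep foldl_rcons. Qed.

Lemma perm_proj_error pi X :
  perm_proj A B pi X - Z = perm_tensor A pi *t (X - Z).
Proof.
rewrite /perm_proj /perm_tensor; elim/last_ind: (perm_seq pi) => [|s i IH].
  by rewrite tmul1.
by rewrite sweep_rcons foldl_rcons proj_error IH tmulA tmulBl tmulBl tmul1.
Qed.

Lemma size_perm_seq pi : size (perm_seq pi) = m.
Proof. by rewrite size_map size_enum_ord. Qed.

Lemma sweep_takeS pi (i : 'I_m) X :
  sweep A B (take i.+1 (perm_seq pi)) X =
  Defs.proj A B (pi i) (sweep A B (take i (perm_seq pi)) X).
Proof.
have -> : take i.+1 (perm_seq pi) = rcons (take i (perm_seq pi)) (pi i).
  rewrite (take_nth (pi i)) ?size_perm_seq //; congr rcons.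
  by rewrite (nth_map i) ?size_enum_ord // nth_ord_enum.
exact: sweep_rcons.
Qed.

Lemma residual_sqr pi X :
  mxnorm (residual A B pi X) ^+ 2 = \sum_(i < m)
    let E := sweep A B (take i (perm_seq pi)) X - Z in
    tdot (Q (pi i) *t E) (Q (pi i) *t E).
Proof.
rewrite mxnorm_sqr mxdot_mxcol; apply: eq_bigr => i _.
by rewrite -tdot_tunfold correctionE.
Qed.

(** Each residual block is an orthogonal projection of the current error, and the next error is what
    remains, so the square of the block is the drop in squared error. *)
Lemma residual_telescope pi X :
  mxnorm (residual A B pi X) ^+ 2 =
  tdot (X - Z) (X - Z) - tdot (perm_proj A B pi X - Z) (perm_proj A B pi X - Z).
Proof.
pose y j := sweep A B (take j (perm_seq pi)) X - Z.
have -> : perm_proj A B pi X - Z = y m.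
  by rewrite /y take_oversize ?size_perm_seq.
have -> : X - Z = y 0%N by rewrite /y take0.
(* The squares are negated so that each increment of the telescoping sum is a drop. *)
transitivity (- tdot (y m) (y m) - - tdot (y 0%N) (y 0%N)); last first.
  by rewrite opprK addrC.
rewrite -(telescope_sumr (fun j => - tdot (y j) (y j)) (leq0n m)) big_mkord.
rewrite residual_sqr; apply: eq_bigr => i _ /=.
rewrite tpinv_proj_pythagoras -/(y i) /y sweep_takeS proj_error.
by rewrite opprK addrC.
Qed.

(** With errors [e] before and [f] after the sweep, [(|e|^2 - |f|^2 + |f - e|^2) / 2 = <e, e -
    f>]. *)
Lemma gammaE pi X : gamma A B pi X = tdot (X - Z) (X - perm_proj A B pi X).
Proof.
rewrite /gamma /delta tnorm_sqr residual_telescope.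
have subZ (U W : tensor R l p n) : U - W = (U - Z) - (W - Z).
  by rewrite opprB subrKA.
rewrite (subZ X (perm_proj _ _ _ _)) (subZ (perm_proj _ _ _ _) X).
move: (X - Z) (perm_proj A B pi X - Z) => e f.
by rewrite !tdotE (tdotC f e); field.
Qed.

(** A fixed point has zero residual, so every correction vanishes and all partial sweeps stay at
    [X]; hence each row equation holds at [X]. *)
Lemma perm_proj_fixed pi X : perm_proj A B pi X = X -> A *t X = B.
Proof.
move=> fX.
have corr0 (i : 'I_m) :
    Q (pi i) *t (sweep A B (take i (perm_seq pi)) X - Z) = 0.
  apply/eqP; rewrite -tdot_eq0; apply/eqP.
  have := residual_telescope pi X; rewrite fX subrr residual_sqr => /psumr_eq0P.
  by apply => // j _ /=; rewrite tdot_tunfold mxdot_ge0.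
have sweepE j : (j <= m)%N -> sweep A B (take j (perm_seq pi)) X = X.
  elim: j => [|j IH] jm; first by rewrite take0.
  apply: (addIr (- Z)).
  rewrite (sweep_takeS pi (Ordinal jm)) proj_error corr0 subr0.
  by rewrite IH // ltnW.
apply: hslice_inj => i; rewrite -AZ; apply/eqP.
rewrite -subr_eq0 !hslice_tmul -tmulBr.
have := corr0 (pi^-1%g i); rewrite permKV sweepE 1?ltnW // => h.
(* Inserting [A_i A_i^+ A_i = A_i] exposes the vanishing correction [A_i^+ A_i (X - Z)]. *)
rewrite -[hslice A i]tmul_tpinvK -!tmulA tmulA -tmulA (tmulA (tpinv _)).
by rewrite h tmul0r.
Qed.

(** [A_i C = A_i] gives [Q_i C = Q_i]; self-adjointness of both projections then makes the
    difference [D] orthogonal to itself. *)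
Lemma row_range_slice i E : C *t (Q i *t E) = Q i *t E.
Proof.
have QC Y : Q i *t (C *t Y) = Q i *t Y.
  rewrite tmulA -(tmulA _ _ C) (tmulA (hslice A i)).
  by rewrite -!hslice_tmul tmul_tpinvK.
apply/eqP; rewrite -subr_eq0 -tdot_eq0; set D := _ - _.
rewrite {1}/D tdotDl tdotNl tpinv_proj_sym tpinv_proj_sym QC.
by rewrite -tpinv_proj_sym subrr.
Qed.

Lemma row_range_sweep s X : C *t (sweep A B s X - X) = sweep A B s X - X.
Proof.
elim/last_ind: s => [|s i IH]; first by rewrite subrr tmul0r.
have -> : sweep A B (rcons s i) X - X =
    sweep A B s X - X - Q i *t (sweep A B s X - Z).
  by rewrite sweep_rcons /Defs.proj correctionE addrAC.
by rewrite tmulBr IH row_range_slice.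
Qed.

Lemma row_range_solution X : C *t (X - Z) = X - Z -> A *t X = B -> X = Z.
Proof.
move=> h AX; apply/eqP; rewrite -subr_eq0 -h -tmulA tmulBr AX AZ.
by rewrite subrr tmul0r.
Qed.

(** An error in the row range may be preceded by [C], which produces the operator whose squared
    spectral norm is [rho]. *)
Lemma perm_proj_contract pi X : C *t (X - Z) = X - Z ->
  tdot (perm_proj A B pi X - Z) (perm_proj A B pi X - Z)
    <= rho A pi * tdot (X - Z) (X - Z).
Proof.
move=> h; rewrite perm_proj_error -{1 2}h !tmulA !tdot_tunfold !tunfoldM.
exact: specnorm_mulmx.
Qed.

End Sweeps.

(** * Invariants of the iteration *)

Section Iterates.
Variables (R : realType) (m l p n : nat).
Variables (A : tensor R m l n) (B : tensor R m p n) (X0 : tensor R l p n).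
Hypothesis consistent : exists Z : tensor R l p n, A *t Z = B.
Implicit Types (X : nat -> tensor R l p n) (pi : 'S_m).

Local Notation C := (tpinv A *t A).
Local Notation Xs := (xstar A B X0).

Lemma xstar_solution : A *t Xs = B.
Proof.
have [Z <-] := consistent.
by rewrite /xstar tmulBl tmul1 tmulDr tmulBr !tmulA tmul_tpinvK subrr addr0.
Qed.

(** For any solution [Z], [X0 - Xs] is the projection [C (X0 - Z)]. *)
Lemma row_range_xstar : C *t (X0 - Xs) = X0 - Xs.
Proof.
have [Z AZ] := consistent.
have -> : X0 - Xs = C *t (X0 - Z).
  rewrite /xstar -AZ tmulBl tmul1 tmulBr !tmulA.
  by rewrite addrCA opprD addrA subrr add0r opprB.
exact: tpinv_proj_idem.
Qed.

Lemma step_tvec tau pi X k (s : 'cV[R]_(window_size tau k + 1)) :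
  tvec (\sum_(i < window_size tau k)
          s (lshift 1 i) 0 *: (X (window_start tau k + i)%N - X k)
        + s (rshift (window_size tau k) 0) 0
            *: (perm_proj A B pi (X k) - X k)) =
  Mmx A B tau pi X k *m s.
Proof.
rewrite linearD linear_sum /Mmx -[s in RHS]vsubmxK mul_row_col; congr (_ + _).
  apply/matrixP => a b; rewrite summxE !mxE; apply: eq_bigr => i _.
  by rewrite ord1 linearZ /= tvecB !mxE mulrC.
apply/matrixP => a b.
by rewrite ord1 linearZ /= !mxE big_ord1 !mxE mulrC.
Qed.

Lemma window_orth tau X k :
  (forall j, (window_start tau k <= j <= k)%N ->
     tdot (X j - X k) (X k - Xs) = 0) ->
  (Vmx tau X k)^T *m tvec (X k - Xs) = 0.
Proof.
move=> h; apply/matrixP => i j;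
rewrite [RHS]mxE -[RHS](h (window_start tau k + i)%N).
  rewrite tdot_tvec !tvecB mxE; apply: eq_bigr => a _.
  by rewrite big_ord1 ord1 !mxE.
rewrite leq_addr /=; have := ltn_ord i; rewrite {2}/window_size ltn_subRL.
exact: ltnW.
Qed.

Lemma error_dvec pi X k :
  mxdot (tvec (X k - Xs)) (dvec A B pi (X k)) = - gamma A B pi (X k).
Proof.
by rewrite -tdot_tvec (gammaE xstar_solution) -tdotNr opprB.
Qed.

(** The row range contains the sweep displacement and all differences of earlier iterates, hence the
    update. The new error is orthogonal to the range of [M], which contains every difference that
    the next window needs. *)
Lemma iterates_invariant tau (pi : nat -> 'S_m) X N :
  tkgk_iterates A B tau X0 pi X N ->
  (forall j, (j <= N)%N -> C *t (X j - Xs) = X j - Xs) /\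
  (forall j, (window_start tau N <= j <= N)%N ->
     tdot (X j - X N) (X N - Xs) = 0).
Proof.
elim: N => [|N IH] [h0 hstep].
  split=> j; rewrite ?leqn0.
    by move=> /eqP ->; rewrite h0 row_range_xstar.
  by move=> /andP[_ /eqP ->]; rewrite subrr tdot0l.
have [hC hV] := IH (conj h0 (fun k kN => hstep k (ltnW kN))).
have [_ [s [hs hX]]] := hstep N (ltnSn N).
set M := Mmx A B tau (pi N) X N in hs.
have stepE : tvec (X N.+1 - X N) = M *m s.
  by rewrite hX -step_tvec -[X N + _ + _]addrA addrAC subrr add0r.
have errE : tvec (X N.+1 - Xs) = tvec (X N - Xs) + M *m s.
  by rewrite -stepE !tvecB [RHS]addrC subrKA.
have orth t : mxdot (M *m t) (tvec (X N.+1 - Xs)) = 0.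
  rewrite mxdot_adj errE (new_error_orth _ _ hs) ?mxdot0r ?error_dvec //.
  exact: window_orth.
have orth_step : tdot (X N.+1 - X N) (X N.+1 - Xs) = 0.
  by rewrite tdot_tvec stepE orth.
split=> j.
  rewrite leq_eqVlt => /predU1P[->|]; last by rewrite ltnS; apply: hC.
  have rangeD (U W : tensor R l p n) :
    C *t U = U -> C *t W = W -> C *t (U + W) = U + W.
    by move=> hU hW; rewrite linearD /= hU hW.
  have rangeZ c (U : tensor R l p n) : C *t U = U -> C *t (c *: U) = c *: U.
    by move=> hU; rewrite tmulZr hU.
  rewrite hX addrAC (addrAC (X N)).
  apply: (rangeD); last first.
    by apply: (rangeZ); apply: row_range_sweep xstar_solution _ _.
  apply: (rangeD); first exact: hC.
  elim/big_ind: _ => [|U W|i _]; [exact: tmul0r|exact: rangeD|apply: (rangeZ)].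

  (* A difference of two iterates is a difference of two errors. *)
  rewrite -(subrKA Xs) -(opprB (X N)).
  rewrite tmulBr !hC //.
  have := ltn_ord i; rewrite {2}/window_size ltn_subRL; exact: ltnW.
case/andP => wj; rewrite leq_eqVlt => /predU1P[->|].
  by rewrite subrr tdot0l.
rewrite ltnS => jN.
(* Going through [X N] leaves [X j - X N], because the last step is orthogonal to the new error. *)
rewrite -(subrKA (X N)) tdotDl -(opprB (X N.+1)) tdotNl orth_step oppr0 addr0.
(* The window start never decreases, so [j] was already in the previous window. *)
have wjN : (window_start tau N <= j)%N.
  by apply: leq_trans wj; apply: leq_sub2r.
move: jN; rewrite leq_eqVlt => /predU1P[->|jN].
  by rewrite subrr tdot0l.
(* For [j < N], [X j - X N] is the column of this index in [V], selected below by a basis vector. *)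
have iq : (j - window_start tau N < window_size tau N)%N.
  exact: ltn_sub2r (leq_ltn_trans wjN jN) jN.
rewrite tdot_tvec; apply: etrans (orth (delta_mx (lshift 1 (Ordinal iq)) 0)).
congr (mxdot _ _); rewrite -colE; apply/matrixP => a b.
rewrite !ord1 [RHS]mxE row_mxEl [RHS]mxE /=.
by rewrite subnKC // tvecB !mxE.
Qed.

End Iterates.

(** * The rate inequalities for one iteration *)

Theorem theorem3p5 (R : realType) (m l p n : nat)
    (A : tensor R m l n) (B : tensor R m p n) (X0 : tensor R l p n)
    (tau : nat) (S : strategy) (pi : nat -> 'S_m)
    (X : nat -> tensor R l p n) (k : nat) :
  (exists Z : tensor R l p n, A *t Z = B) ->
  (1 <= tau)%N ->
  strategy_outcome S pi ->
  tkgk_iterates A B tau X0 pi X k ->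
  (A *t X k = B -> X k = xstar A B X0) /\
  (A *t X k <> B ->
    let bz2 := beta A B tau (pi k) X k * zeta A B (pi k) X0 (X k) ^+ 2 in
    [/\ exists Y : tensor R l p n, tkgk_step A B tau (pi k) X k Y,
        forall Y : tensor R l p n, tkgk_step A B tau (pi k) X k Y ->
          tnorm (Y - xstar A B X0) ^+ 2
            <= (1 - bz2) * tnorm (X k - xstar A B X0) ^+ 2,
        1 - bz2 <= rho A (pi k)
      & mxnorm (residual A B (pi k) (X k)) ^+ 2
          <> tnorm (X k - perm_proj A B (pi k) (X k)) ^+ 2 ->
        1 - bz2 < rho A (pi k)]).
Proof.
move=> consistent _ _ run.
have [hC hV] := iterates_invariant consistent run.
have Xs_sol := xstar_solution X0 consistent.
have hCk := hC k (leqnn k).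
split=> [|AX]; first exact: (row_range_solution Xs_sol hCk).
set Xs := xstar A B X0 in Xs_sol hC hV hCk *.
set PX := perm_proj A B (pi k) (X k).
set e := X k - Xs in hC hV hCk *.
set d := dvec A B (pi k) (X k).
set g := gamma A B (pi k) (X k).
(* An iterate fixed by the sweep would solve the system, so the stopping test fails here. *)
have delta_neq0 : delta A B (pi k) (X k) <> 0.
  rewrite /delta tnorm_sqr => /eqP; rewrite tdot_eq0 subr_eq0 => /eqP h.
  exact/AX/(perm_proj_fixed Xs_sol h).
have e_gt0 : 0 < tdot e e.
  rewrite tdot_tunfold lt_neqAle mxdot_ge0 andbT eq_sym -tdot_tunfold tdot_eq0.
  by rewrite subr_eq0; apply: contra_notN AX => /eqP ->.
have dd : mxdot d d = delta A B (pi k) (X k).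
  by rewrite /delta tnorm_sqr tdot_tvec.
have d_gt0 : 0 < mxdot d d.
  by rewrite lt_neqAle mxdot_ge0 andbT eq_sym dd; apply/eqP.
have g_gt0 : 0 < g.
  by rewrite divr_gt0 // ltr_wpDl ?sqr_ge0 // -dd.
have Ve : (Vmx tau X k)^T *m tvec e = 0 by apply: window_orth hV.
have de : mxdot (tvec e) d = - g by apply: error_dvec.
have [s0 hs0] := normal_equations_solvable Ve de.
pose W := mxnorm (Vmx tau X k *m mpinv (Vmx tau X k) *m d) ^+ 2.
have bound s : (Mmx A B tau (pi k) X k)^T *m Mmx A B tau (pi k) X k *m s
    = g *: last_basis R (window_size tau k) ->
    mxdot (tvec e + Mmx A B tau (pi k) X k *m s)
          (tvec e + Mmx A B tau (pi k) X k *m s)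
    <= tdot e e - g ^+ 2 / (mxdot d d - W).
  move=> hs; rewrite (tdot_tvec e e).
  by apply: (new_error_norm Ve de hs); rewrite gt_eqF.
have dW_gt0 : 0 < mxdot d d - W.
  exact: (complement_gt0 Ve de (lt0r_neq0 g_gt0)).
(* [beta = |d|^2 / (|d|^2 - W)] and [zeta^2 = g^2 / (|e|^2 |d|^2)], so [|d|^2] cancels. *)
have bzE : beta A B tau (pi k) X k * zeta A B (pi k) X0 (X k) ^+ 2
    = g ^+ 2 / (mxdot d d - W) / tdot e e.
  rewrite /beta /zeta -/d -/W !mxnorm_sqr -/Xs -/e -gammaE // -/g.
  rewrite [(g / _) ^+ 2]expr_div_n (exprMn _ (tnorm e)) !tnorm_sqr.
  rewrite (tdot_tvec (_ - X k)) -/d.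
  by field; rewrite !gt_eqF.
have shrink : (1 - g ^+ 2 / (mxdot d d - W) / tdot e e) * tdot e e
    = tdot e e - g ^+ 2 / (mxdot d d - W).
  by rewrite mulrBl mul1r divfK ?gt_eqF.
have Te : tdot (PX - Xs) (PX - Xs) = tdot e e - 2 * g + mxdot d d.
  have -> : PX - Xs = e + (PX - X k) by rewrite [RHS]addrC subrKA.
  have -> : g = - tdot e (PX - X k) by rewrite -[g]opprK -de -tdot_tvec.
  rewrite -tdot_tvec tdotDl (tdotDr e e) (tdotDr (PX - X k) e).
  by rewrite (tdotC (PX - X k) e); ring.
(* This square is the slack in [g^2 / |d|^2 >= 2 g - |d|^2]. *)
have gap : 0 <= (g - mxdot d d) ^+ 2 / mxdot d d.
  by rewrite divr_ge0 ?sqr_ge0 ?ltW.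
have gapE : (g - mxdot d d) ^+ 2 / mxdot d d =
    g ^+ 2 / mxdot d d - 2 * g + mxdot d d.
  by field; rewrite gt_eqF.
have W_ge : g ^+ 2 / mxdot d d <= g ^+ 2 / (mxdot d d - W).
  by rewrite ler_pM2l ?exprn_gt0 // lef_pV2 ?posrE // gerBl sqr_ge0.
have contr := perm_proj_contract Xs_sol (pi k) hCk.
rewrite -/PX Te -/e in contr.
rewrite /= bzE; split.
- exists (X k + \sum_(i < window_size tau k)
      s0 (lshift 1 i) 0 *: (X (window_start tau k + i)%N - X k)
    + s0 (rshift (window_size tau k) 0) 0 *: (PX - X k)).
  by split=> //; exists s0.
- move=> Y [_ [s [hs ->]]].
  rewrite !tnorm_sqr -/e shrink tdot_tvec; apply: le_trans (bound s hs).
  by rewrite -step_tvec -[X k + _ + _]addrA addrAC tvecD.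
(* After multiplication by [|e|^2], the bound chains [W_ge], [gap] and [contr]. *)
- rewrite -(ler_pM2r e_gt0) shrink; lra.
- rewrite mxnorm_sqr tnorm_sqr => hr; rewrite -(ltr_pM2r e_gt0) shrink.
  (* The slack vanishes only if [g = |d|^2]; as [g] is the mean of [|r|^2] and [|d|^2], these would
     then agree. *)
  have : 0 < (g - mxdot d d) ^+ 2 / mxdot d d.
    rewrite divr_gt0 // exprn_even_gt0 //= subr_eq0.
    apply: contra_notN hr => /eqP.
    rewrite /g /gamma -dd mxnorm_sqr => h.
    rewrite -(opprB PX) tdotNl tdotNr opprK tdot_tvec -/d.
    lra.
  lra.
Qed.
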